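(* Let $G$ be a group and $Q=\mathrm{Core}(G)$. The following are equivalent: (i) $Q$ is abelian. (ii) $G$ is $2$-step nilpotent and, for all $t\in\mathbb{N}$ and all $x_1,\dots,x_t\in G$, if $x_1\cdots x_t=(x_t\cdots x_1)^{-1}$ then $x_1\cdots x_t\in Z(G)$.
   Context: A quandle is a set $Q$ with a binary operation $*$ such that every left translation $L_x:y\mapsto x*y$ is bijective, $x*(y*z)=(x*y)*(x*z)$ and $x*x=x$ for all $x,y,z\in Q$. For a group $G$, $\mathrm{Core}(G)$ is the quandle with underlying set $G$ and operation $x*y=xy^{-1}x$. $Z(G)$ is the center of $G$; ''$2$-step nilpotent'' means nilpotent of class at most $2$, i.e. $[G,G]\le Z(G)$. The displacement group of $Q$ is $\mathrm{Dis}(Q)=\langle L_xL_y^{-1} : x,y\in Q\rangle\le\mathrm{Sym}(Q)$. A quandle is abelian if it is abelian in the sense of (Freese–McKenzie) commutator theory for universal algebras, viewed as an algebra $(Q,*,\backslash)$ with $x\backslash y=L_x^{-1}(y)$: for every term $t(x,y_1,\dots,y_n)$ and all $a,b,u_i,v_i\in Q$, $t(a,u_1,\dots,u_n)=t(a,v_1,\dots,v_n)$ implies $t(b,u_1,\dots,u_n)=t(b,v_1,\dots,v_n)$. It is a known fact that this is equivalent to: $\mathrm{Dis}(Q)$ is abelian and acts semiregularly on $Q$ (all point stabilizers are trivial). *)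

(* Defs.v *)
From mathcomp Require Import all_boot.

Set Implicit Arguments.
Unset Strict Implicit.
Unset Printing Implicit Defensive.

Local Open Scope group_scope.

(* Bijectivity of the left translations [qop x] is stated by giving their
   inverses: the two cancellation laws determine [qldiv x] as the inverse of
   [qop x], so that it is not additional data. *)
Record quandle := Quandle {
  qcarrier :> Type;
  qop : qcarrier -> qcarrier -> qcarrier;
  qldiv : qcarrier -> qcarrier -> qcarrier;
  qopK : forall x, cancel (qop x) (qldiv x);
  qldivK : forall x, cancel (qldiv x) (qop x);
  qopD : forall x y z, qop x (qop y z) = qop (qop x y) (qop x z);
  qopxx : forall x, qop x x = x
}.

Inductive qterm (V : Type) : Type :=
| QVar of V
| QOp of qterm V & qterm V
| QLdiv of qterm V & qterm V.

Fixpoint qeval (Q : quandle) (V : Type) (e : V -> Q) (t : qterm V) : Q :=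
  match t with
  | QVar v => e v
  | QOp t1 t2 => qop (qeval e t1) (qeval e t2)
  | QLdiv t1 t2 => qldiv (qeval e t1) (qeval e t2)
  end.

(* A term t(x, y_1, ..., y_n) has its variables in [option 'I_n]: [None] is x
   and [Some i] is the i-th y. The valuation [oapp u a] sends x to a and the
   i-th y to [u i]. *)
Definition abelian_quandle (Q : quandle) : Prop :=
  forall (n : nat) (t : qterm (option 'I_n)) (a b : Q) (u v : 'I_n -> Q),
    qeval (oapp u a) t = qeval (oapp v a) t ->
    qeval (oapp u b) t = qeval (oapp v b) t.

Section Core.
Variable G : groupType.
Implicit Types x y z : G.

Definition core_op x y : G := x * y^-1 * x.

Lemma core_opK x : cancel (core_op x) (core_op x).
Proof. by move=> y; rewrite /core_op !invgM invgK !mulgA mulgV mul1g mulgVK. Qed.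

Lemma core_opD x y z :
  core_op x (core_op y z) = core_op (core_op x y) (core_op x z).
Proof. by rewrite /core_op !invgM !invgK !mulgA !mulgK mulgVK. Qed.

Lemma core_opxx x : core_op x x = x.
Proof. by rewrite /core_op mulgV mul1g. Qed.

(* The left translations of Core(G) are involutions, whence [qldiv = qop]. *)
Definition Core : quandle := Quandle core_opK core_opK core_opD core_opxx.

End Core.

Section Nilpotency.
Variable G : groupType.

Definition is_central (z : G) : Prop := forall x : G, commute z x.

Inductive generated (S : G -> Prop) : G -> Prop :=
| gen_in x : S x -> generated S x
| gen_one : generated S 1
| gen_mul x y : generated S x -> generated S y -> generated S (x * y)
| gen_inv x : generated S x -> generated S x^-1.

Definition in_derived : G -> Prop :=
  generated (fun g => exists x y : G, g = [~ x, y]).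

End Nilpotency.

Definition two_step_nilpotent (G : groupType) : Prop :=
  forall g : G, in_derived g -> is_central g.

(* Main.v *)
Require Import Defs.
From mathcomp Require Import all_boot.

(** Write L_x for the left translations of Core(G); they are involutions, and
    L_(L_x y) = L_x L_y L_x, so every term function of Core(G) is a composite
    of translations by variables applied to a variable.  The group G is 2-step
    nilpotent iff L_x L_y L_z = L_z L_y L_x for all x, y, z, and the condition on
    products says that an even composite of translations with a fixed point is
    the identity.  Given both, changing the distinguished argument from a to b
    in a composite of translations by variables amounts to composing on the left
    with an even composite that does not depend on the other arguments; this
    yields the term condition.  Conversely, both properties are instances of the
    term condition. *)

Set Implicit Arguments.
Unset Strict Implicit.
Unset Printing Implicit Defensive.

Local Open Scope group_scope.

Section CoreTranslations.
Variable G : groupType.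
Implicit Types (x y z t : G) (s : seq G).

Lemma core_op_rmul x y z : core_op (x * z) (y * z) = core_op x y * z.
Proof. by rewrite /core_op invgM !mulgA mulgK. Qed.

Lemma core_op_conj x y z :
  core_op (core_op x y) z = core_op x (core_op y (core_op x z)).
Proof. by rewrite core_opD core_opK. Qed.

Lemma foldr_core_op_conj s y z :
  core_op (foldr (@core_op G) y s) z = foldr (@core_op G) z (s ++ y :: rev s).
Proof.
elim: s y z => [|x s IHs] y z //=.
rewrite core_op_conj IHs rev_cons -rcons_cons -cats1 catA.
by rewrite [in RHS]foldr_cat.
Qed.

Lemma foldr_core_op_rev s : cancel (fun y => foldr (@core_op G) y s)
                                   (fun y => foldr (@core_op G) y (rev s)).
Proof.
elim: s => [|x s IHs] y //=.
by rewrite rev_cons foldr_rcons core_opK IHs.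
Qed.

Lemma foldr_core_op_rmul s y z :
  foldr (@core_op G) (y * z) [seq x * z | x <- s] =
    foldr (@core_op G) y s * z.
Proof. by elim: s => //= x s ->; rewrite core_op_rmul. Qed.

(** Links composites of translations to products taken in both orders: since [core_op x] inverts its
    argument, each new letter inverts [w] entrywise, keeping its order, and puts [x] in front. *)
Lemma foldr_core_op_prod s : exists w : seq G, forall y,
  foldr (@core_op G) y s =
    \prod_(x <- w) x * (if odd (size s) then y^-1 else y) * \prod_(x <- rev w) x.
Proof.
elim: s => [|x s [w IHw]].
  by exists [::] => y; rewrite /= !big_nil mul1g mulg1.
exists (x :: [seq x^-1 | x <- w]) => y /=.
rewrite IHw rev_cons -cats1 big_cat big_seq1 big_cons /=.
rewrite -map_rev !big_map !prodgV revK /core_op !invgM.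
by case: (odd _); rewrite /= ?invgK !mulgA.
Qed.

(** Both sides amount to the identity x y z y x = y x z x y. It follows from xy = yx[x,y] by moving
    the central commutator across z. *)
Lemma two_step_nilpotentP : two_step_nilpotent G <->
  forall x y z t, core_op x (core_op y (core_op z t)) =
                  core_op z (core_op y (core_op x t)).
Proof.
split=> [nilG | LLL].
  have xyzyx x y z : x * y * z * y * x = y * x * z * x * y.
    have cC : is_central [~ x, y] by apply/nilG/gen_in; exists x, y.
    have cyx := cC (y * x).
    rewrite -(mulgA _ y x) -(mulgA _ x y) (commgC x y).
    by rewrite -(mulgA (y * x)) (cC z) -(mulgA (y * x)) -(mulgA z) cyx !mulgA.
  move=> x y z t; apply: (mulIg y^-1).
  have := xyzyx (x * y^-1) (z * y^-1) (y * t^-1).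
  by rewrite /core_op !invgM !invgK !mulgA !mulgVK.
have xyzyx x y z : x * y * z * y * x = y * x * z * x * y.
  have := LLL x 1 y z^-1.
  by rewrite /core_op !invgM !invgK invg1 !mulgA !mulg1.
move=> g; elim=> [_ [x [y ->]] | | h k _ ch _ ck | h _ ch] z.
- have -> : [~ x, y] = (y * x)^-1 * (x * y) by rewrite /commg /conjg invgM !mulgA.
  (* With v = xy and u = yx, the identity v w u = u w v gives u^-1 v w = w v u^-1; at w = 1 it shows
     that u^-1 and v commute, so u^-1 v is central. *)
  have uzv w : x * y * w * (y * x) = y * x * w * (x * y).
    by rewrite !mulgA xyzyx.
  have uv : commute (y * x)^-1 (x * y).
    by apply/commute_sym/commuteV; have := uzv 1; rewrite !mulg1.
  apply: (mulgI (y * x)); apply: (mulIg (y * x)).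
  rewrite {2}uv -!(mulgA (y * x)^-1) mulVKg uzv.
  by rewrite -[RHS]mulgA -[z * _ * _]mulgA mulgVK mulgA.
- exact/commute_sym/commute1.
- by apply/commute_sym/commuteM; apply/commute_sym; [exact: ch | exact: ck].
- exact/commute_sym/commuteV/commute_sym/ch.
Qed.

End CoreTranslations.

Lemma prod_rev_ord (G : groupType) n (x : 'I_n -> G) :
  \prod_(i <- rev (index_enum 'I_n)) x i = \prod_(i < n) x (rev_ord i).
Proof.
suff -> : rev (index_enum 'I_n) = map (@rev_ord n) (index_enum 'I_n).
  by rewrite big_map.
rewrite [index_enum _]unlock -enumT; apply: (inj_map val_inj).
apply: (@eq_from_nth _ 0) => [|i]; first by rewrite !(size_map, size_rev).
rewrite size_map size_rev size_enum_ord => lt_in; pose i0 := Ordinal lt_in.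
rewrite map_rev val_enum_ord nth_rev ?size_iota // -map_comp.
rewrite (nth_map i0) ?size_enum_ord //= nth_enum_ord // nth_iota ?add0n //.
by rewrite ltn_subrL /= (leq_ltn_trans _ lt_in).
Qed.

Section Terms.
Variable G : groupType.
Implicit Types (a b y z : G) (s : seq G).

Lemma qeval_Core_foldr (V : Type) (t : qterm V) : exists (l : seq V) (v : V),
  forall e : V -> G,
    qeval (Q := Core G) e t = foldr (@core_op G) (e v) (map e l).
Proof.
have op_foldr (t1 t2 : qterm V) l1 v1 l2 v2 :
    (forall e : V -> G,
      qeval (Q := Core G) e t1 = foldr (@core_op G) (e v1) (map e l1)) ->
    (forall e : V -> G,
      qeval (Q := Core G) e t2 = foldr (@core_op G) (e v2) (map e l2)) ->
  exists l v, forall e : V -> G,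
    core_op (qeval (Q := Core G) e t1) (qeval (Q := Core G) e t2) =
      foldr (@core_op G) (e v) (map e l).
  (* The block [l1 ++ v1 :: rev l1] is the translation by the value of [t1]. *)
  move=> t1E t2E; exists (l1 ++ v1 :: rev l1 ++ l2), v2 => e.
  by rewrite t1E t2E foldr_core_op_conj map_cat /= map_cat map_rev -cat_cons
             catA [in RHS]foldr_cat.
elim: t => [v | t1 [l1 [v1 t1E]] t2 [l2 [v2 t2E]] |
               t1 [l1 [v1 t1E]] t2 [l2 [v2 t2E]]].
- by exists [::], v.
- exact: op_foldr t1E t2E.
- exact: op_foldr t1E t2E.
Qed.

Definition palindromic_central : Prop :=
  forall (t : nat) (x : 'I_t -> G),
    \prod_(i < t) x i = (\prod_(i < t) x (rev_ord i))^-1 ->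
    is_central (\prod_(i < t) x i).

Lemma palindromic_central_seq s : palindromic_central ->
  \prod_(x <- s) x * \prod_(x <- rev s) x = 1 -> is_central (\prod_(x <- s) x).
Proof.
move=> palG s1.
have sE : \prod_(x <- s) x = \prod_(i < size s) nth 1 s i.
  by rewrite (big_nth 1) big_mkord.
have rsE : \prod_(x <- rev s) x = \prod_(i < size s) nth 1 s (rev_ord i).
  rewrite (big_nth 1) big_mkord size_rev.
  by apply: eq_bigr => i _; rewrite nth_rev.
rewrite sE; apply: palG; rewrite -sE -rsE.
by apply: (mulIg (\prod_(x <- rev s) x)); rewrite s1 mulVg.
Qed.

Lemma foldr_core_op_fix s y z : palindromic_central -> ~~ odd (size s) ->
  foldr (@core_op G) z s = z -> foldr (@core_op G) y s = y.
Proof.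
(* Right translations are automorphisms of Core(G): reduce to z = 1. *)
move=> palG ev_s fix_z; pose s' := [seq x * z^-1 | x <- s].
have [w wE] := foldr_core_op_prod s'.
rewrite size_map (negPf ev_s) in wE.
have w1 : \prod_(x <- w) x * \prod_(x <- rev w) x = 1.
  by rewrite -[X in X * _]mulg1 -wE -(mulgV z) foldr_core_op_rmul fix_z.
apply: (mulIg z^-1); rewrite -foldr_core_op_rmul wE.
by rewrite (palindromic_central_seq palG w1) -mulgA w1 mulg1.
Qed.

(* For D an even composite, L_x D = (L_a D L_a) L_x: the conjugate of D by a
   translation does not depend on the translation. *)
Lemma core_op_foldr_even x a y s : two_step_nilpotent G -> ~~ odd (size s) ->
  core_op x (foldr (@core_op G) y s) =
    core_op a (foldr (@core_op G) (core_op a (core_op x y)) s).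
Proof.
move/two_step_nilpotentP=> LLL.
(* Letters are removed in pairs, which keeps the length even; [LLL] moves the outer translation past
   a pair, reversing it. *)
have [n] := ubnP (size s); elim: n s => // n IHn [|u [|v s]] //=.
  by rewrite core_opK.
rewrite negbK ltnS => /ltnW lt_s ev_s.
by rewrite LLL IHn // (LLL a).
Qed.

(** Reading [l] from its end, an ordinary variable replaces D by L_a D L_a, and the distinguished
    one replaces it by L_b D L_a; neither involves [u]. *)
Lemma foldr_core_op_change_base n a b (l : seq (option 'I_n)) :
  two_step_nilpotent G -> exists2 d : seq G, ~~ odd (size d) &
  forall (u : 'I_n -> G) z,
    foldr (@core_op G) z (map (oapp u b) l) =
      foldr (@core_op G) (foldr (@core_op G) z (map (oapp u a) l)) d.
Proof.
move=> nilG; elim: l => [|v l [d ev_d dE]]; first by exists [::].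
case: v => [i|].
  exists (a :: rcons d a) => [|u z]; first by rewrite /= size_rcons /= negbK.
  by rewrite /= dE foldr_rcons; apply: core_op_foldr_even.
exists (b :: rcons d a) => [|u z]; first by rewrite /= size_rcons /= negbK.
by rewrite /= dE foldr_rcons core_opK.
Qed.

Lemma abelian_Core : two_step_nilpotent G -> palindromic_central ->
  abelian_quandle (Core G).
Proof.
move=> nilG palG n t a b u v; have [l [x tE]] := qeval_Core_foldr t.
rewrite !tE; have [d _ dE] := foldr_core_op_change_base a b l nilG.
case: x {tE} => [i|] /= eq_a; rewrite !dE; congr foldr; first exact: eq_a.
(* Here the distinguished variable is also the innermost one. The [u]-composite followed by the
   inverse of the [v]-composite is even and fixes [a], so it is the identity and can be evaluated at
   [b]. *)
have eq_id y : foldr (@core_op G) y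
    (rev (map (oapp v a) l) ++ map (oapp u a) l) = y.
  apply: (@foldr_core_op_fix _ _ a) palG _ _.
    by rewrite size_cat size_rev !size_map addnn odd_double.
  by rewrite foldr_cat eq_a foldr_core_op_rev.
have := eq_id b; rewrite foldr_cat => /(congr1 (fun y =>
  foldr (@core_op G) y (rev (rev (map (oapp v a) l))))).
by rewrite (foldr_core_op_rev (rev _)) revK.
Qed.

Lemma abelian_Core_nilpotent : abelian_quandle (Core G) -> two_step_nilpotent G.
Proof.
move=> abG; apply/two_step_nilpotentP => x y z t.
pose y_ i : qterm (option 'I_4) := QVar (Some (inord i)).
(* When the distinguished variable is [y], both valuations give L_x t, because translations are
   involutions; when it is [z], they give L_x L_y L_z t and L_z L_y L_x t. *)
pose T := QOp (y_ 0) (QOp (y_ 2)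
  (QOp (QVar None) (QOp (y_ 2) (QOp (y_ 1%N) (y_ 3))))).
have := abG 4 T y z (fun i => nth 1 [:: x; y; y; t] i)
                    (fun i => nth 1 [:: y; x; y; t] i).
by rewrite /= !inordK //= !core_opK => /(_ erefl).
Qed.

Lemma abelian_Core_palindromic :
  abelian_quandle (Core G) -> palindromic_central.
Proof.
move=> abG n x palx z.
pose y_ i : qterm (option 'I_n.+1) := QVar (Some i).
(* Variable 0 always takes the value 1, so each pair of translations sends w to x_i w x_i. With P
   the product of the x_i, [u] yields P w P^-1 by [palx], and [v] yields w; they agree at w = 1,
   hence at [z]. *)
pose T := foldr (fun i t => QOp (y_ (lift ord0 i)) (QOp (y_ ord0) t))
  (QVar None) (index_enum 'I_n).
pose u i : G := if unlift ord0 i is Some j then x j else 1.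
pose v (_ : 'I_n.+1) : G := 1.
have opE (f : 'I_n -> G) y (r : seq 'I_n) :
  foldr (fun i => core_op (f i) \o core_op 1) y r =
    \prod_(i <- r) f i * y * \prod_(i <- rev r) f i.
  elim: r => [|i r IHr]; first by rewrite !big_nil mul1g mulg1.
  rewrite rev_cons -cats1 big_cat big_seq1 big_cons /= IHr.
  by rewrite /core_op !invgM !invgK !invg1 !mul1g !mulg1 !mulgA.
have TE (w : G) : qeval (Q := Core G) (oapp u w) T =
    \prod_(i < n) x i * w * (\prod_(i < n) x i)^-1.
  rewrite {2}palx invgK -prod_rev_ord -opE /T; elim: (index_enum _) => //= i r ->.
  by rewrite /u liftK unlift_none.
have T1E (w : G) : qeval (Q := Core G) (oapp v w) T = w.
  by rewrite /T; elim: (index_enum _) => //= i r ->; rewrite core_opK.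
have := abG n.+1 T (1 : G) z u v; rewrite !TE !T1E mulg1 mulgV => /(_ erefl) zE.
by rewrite /commute -[in RHS]zE mulgVK.
Qed.

End Terms.

Theorem proposition5p3 (G : groupType) :
  abelian_quandle (Core G) <->
  two_step_nilpotent G /\
  (forall (t : nat) (x : 'I_t -> G),
     (\prod_(i < t) x i = (\prod_(i < t) x (rev_ord i))^-1)%g ->
     is_central (\prod_(i < t) x i)%g).
Proof.
split=> [abG | [nilG palG]]; last exact: abelian_Core.
by split; [exact: abelian_Core_nilpotent | exact: abelian_Core_palindromic].
Qed.
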